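(* Let $\Gamma$ be a discrete group of isometries acting freely on Euclidean space $\mathbb{R}^n$, let $M=\mathbb{R}^n/\Gamma$ be the corresponding locally Euclidean space, and let $p:\mathbb{R}^n\to M$ be the canonical projection. Then $M$ admits a quasiregular (respectively, having both closed and non-closed trajectories) Killing vector field of constant length if and only if $\Gamma$ contains an element of the form $f=(A,(I-A)b+a)$, where $I$ is the identity linear transformation, the vector $a\neq 0$ is invariant under all transformations in the group $d\Gamma$, the vector $b$ is orthogonal to $a$, and $A\neq I$ has finite (respectively, infinite) order. Moreover, the corresponding Killing vector field is the field $dp(\mathbf{0},a)$, and its singular trajectory goes through the point $p(b)$.
   Context: An isometry $g$ of $\mathbb{R}^n$ is written $g=(A,c)$ with $A\in O(n)$, $c\in\mathbb{R}^n$, meaning $g(x)=A(x)+c$. The map $d:\mathrm{Isom}(\mathbb{R}^n)\to O(n)$, $d(A,c)=A$, is the natural epimorphism, and $d\Gamma$ is the image of $\Gamma$ under $d$. A Killing vector field on $\mathbb{R}^n$ is written $(W,w)$, meaning $X(x)=W(x)+w$ with $W$ skew-symmetric and $w\in\mathbb{R}^n$; $(\mathbf{0},a)$ is the parallel field with constant value $a$. When $a$ is $d\Gamma$-invariant, $dp(\mathbf{0},a)$ denotes the vector field on $M$ to which the field $(\mathbf{0},a)$ projects. A Killing vector field is a smooth vector field $X$ with $L_Xg=0$; it has constant length if $g(X,X)$ is constant, and such fields are understood to be nontrivial. A Killing field of constant length is quasiregular if all its integral curves are closed and there exist integral curves of different lengths. In the quasiregular case a trajectory is singular if its minimal period is smaller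 than the maximal minimal period of the trajectories (nontrivial isotropy for the effective circle action generated by the field); in the case of both closed and non-closed trajectories, ''singular trajectory'' refers to a closed trajectory. *)

(* Defs.v *)
From HB Require Import structures.
From mathcomp Require Import all_boot all_order all_algebra.
From mathcomp Require Import all_classical all_reals all_analysis.

Set Implicit Arguments.
Unset Strict Implicit.
Unset Printing Implicit Defensive.
Import Order.TTheory GRing.Theory Num.Theory.
Import numFieldNormedType.Exports.
Local Open Scope classical_set_scope.
Local Open Scope ring_scope.

Section Euclidean.
Context (R : realType) (n : nat).
Implicit Types (g h : 'M[R]_n * 'cV[R]_n) (A W : 'M[R]_n).
Implicit Types (a b u v w x y : 'cV[R]_n) (Y : 'cV[R]_n -> 'cV[R]_n).

Definition dot u v : R := \sum_i u i 0 * v i 0.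

Definition orthogonal_mx A : Prop := A^T *m A = 1%:M.

Definition finite_order A : Prop := exists2 k, (0 < k)%N & A ^+ k = 1%:M.

(* A pair (A, c) stands for the map x |-> A x + c. *)
Definition act g x : 'cV[R]_n := g.1 *m x + g.2.

Definition tangent_act g (xv : 'cV[R]_n * 'cV[R]_n) : 'cV[R]_n * 'cV[R]_n :=
  (act g xv.1, g.1 *m xv.2).

Definition isom_mul g h : 'M[R]_n * 'cV[R]_n :=
  (g.1 *m h.1, g.1 *m h.2 + g.2).

Definition isom_inv g : 'M[R]_n * 'cV[R]_n :=
  (invmx g.1, - (invmx g.1 *m g.2)).

Record isom_group := IsomGroup {
  elts : set ('M[R]_n * 'cV[R]_n);
  isom_orthogonal : forall g, elts g -> orthogonal_mx g.1;
  isom_group1 : elts (1%:M, 0);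
  isom_groupM : forall g h, elts g -> elts h -> elts (isom_mul g h);
  isom_groupV : forall g, elts g -> elts (isom_inv g)
}.

Definition discrete_group (G : isom_group) : Prop :=
  elts G `<=` isolated (elts G).

Definition acts_freely (G : isom_group) : Prop :=
  forall g x, elts G g -> act g x = x -> g = (1%:M, 0).

Definition d_invariant (G : isom_group) a : Prop :=
  forall g, elts G g -> g.1 *m a = a.

Definition affine_field W w : 'cV[R]_n -> 'cV[R]_n := fun x => W *m x + w.

Fixpoint Ck (k : nat) Y : Prop :=
  if k is k'.+1 then
    (forall x, differentiable Y x) /\ (forall v, Ck k' ('D_v Y))
  else continuous Y.

Definition smooth Y : Prop := forall k, Ck k Y.

(* The value (L_Y g)(v, w) at x for the flat metric g = dot: extending v and
   w to constant fields, Y (g (v, w)) = 0 and [Y, v] = - 'D_v Y. *)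
Definition lie_metric Y x v w : R := dot ('D_v Y x) w + dot v ('D_w Y x).

Definition euclidean_killing Y : Prop :=
  smooth Y /\ forall x v w, lie_metric Y x v w = 0.

Lemma act_mul g h x : act (isom_mul g h) x = act g (act h x).
Proof. by rewrite /act /isom_mul /= mulmxDr mulmxA addrA. Qed.

Lemma tangent_act1 xv : tangent_act (1%:M, 0) xv = xv.
Proof. by case: xv => x v; rewrite /tangent_act /act /= !mul1mx addr0. Qed.

Lemma tangent_act_mul g h xv :
  tangent_act (isom_mul g h) xv = tangent_act g (tangent_act h xv).
Proof. by rewrite /tangent_act /= act_mul mulmxA. Qed.

Lemma tangent_actK (G : isom_group) g xv :
  elts G g -> tangent_act (isom_inv g) (tangent_act g xv) = xv.
Proof.
move=> Gg; rewrite -tangent_act_mul -[RHS]tangent_act1; congr tangent_act.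
have /mulmx1_unit[_ Ug] := isom_orthogonal Gg.
by rewrite /isom_mul /= mulVmx // addrN.
Qed.

End Euclidean.

Section Quotient.
Context (R : realType) (n : nat) (G : isom_group R n).
Implicit Types (x y v w a : 'cV[R]_n) (xv yw : 'cV[R]_n * 'cV[R]_n).

Definition orbit_rel x y : bool := `[< exists2 g, elts G g & y = act g x >].

Definition tangent_orbit_rel xv yw : bool :=
  `[< exists2 g, elts G g & yw = tangent_act g xv >].

Lemma tangent_orbit_refl : reflexive tangent_orbit_rel.
Proof.
move=> xv; apply/asboolP; exists (1%:M, 0); first exact: isom_group1.
by rewrite tangent_act1.
Qed.

Lemma tangent_orbit_sym : symmetric tangent_orbit_rel.
Proof.
suff imp xv yw : tangent_orbit_rel xv yw -> tangent_orbit_rel yw xv.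
  by move=> xv yw; apply/idP/idP; apply: imp.
move=> /asboolP[g Gg ->]; apply/asboolP; exists (isom_inv g).
  exact: isom_groupV.
by rewrite (tangent_actK _ Gg).
Qed.

Lemma tangent_orbit_trans : transitive tangent_orbit_rel.
Proof.
move=> yw xv zu /asboolP[g Gg ->] /asboolP[h Gh ->]; apply/asboolP.
by exists (isom_mul h g); [exact: isom_groupM | rewrite tangent_act_mul].
Qed.

Lemma orbit_relE x y : orbit_rel x y = tangent_orbit_rel (x, 0) (y, 0).
Proof.
apply/asboolP/asboolP => -[g Gg]; last by case=> ->; exists g.
by move=> ->; exists g => //; rewrite /tangent_act /= mulmx0.
Qed.

Lemma orbit_refl : reflexive orbit_rel.
Proof. by move=> x; rewrite orbit_relE tangent_orbit_refl. Qed.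

Lemma orbit_sym : symmetric orbit_rel.
Proof. by move=> x y; rewrite !orbit_relE tangent_orbit_sym. Qed.

Lemma orbit_trans : transitive orbit_rel.
Proof. by move=> y x z; rewrite !orbit_relE; apply: tangent_orbit_trans. Qed.

Canonical orbit_equiv := EquivRel orbit_rel orbit_refl orbit_sym orbit_trans.

Canonical tangent_orbit_equiv :=
  EquivRel tangent_orbit_rel
    tangent_orbit_refl tangent_orbit_sym tangent_orbit_trans.

Local Open Scope quotient_scope.

Definition quot_space : Type := {eq_quot orbit_rel}.
HB.instance Definition _ := Choice.on quot_space.
HB.instance Definition _ := EqQuotient.on quot_space.

(* The tangent bundle of R^n / G, as the quotient of the tangent bundle of R^n
   by the differentials of the elements of G. *)
Definition quot_tangent : Type := {eq_quot tangent_orbit_rel}.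
HB.instance Definition _ := Choice.on quot_tangent.
HB.instance Definition _ := EqQuotient.on quot_tangent.

Definition quot_proj x : quot_space := \pi_quot_space x.

Definition tangent_proj xv : quot_tangent := \pi_quot_tangent xv.

Definition tnorm (u : quot_tangent) : R := Num.sqrt (dot (repr u).2 (repr u).2).

Lemma tnormE x v : tnorm (tangent_proj (x, v)) = Num.sqrt (dot v v).
Proof.
have dotE a b : dot a b = (a^T *m b) 0 0.
  by rewrite mxE; apply: eq_bigr => i _; rewrite mxE.
rewrite /tnorm /tangent_proj; case: piP => yw /eqP.
rewrite eqmodE /= => /asboolP[g Gg ->] /=.
by rewrite !dotE trmx_mul mulmxA -(mulmxA v^T) (isom_orthogonal Gg) mulmx1.
Qed.

(* The type carries no base-point condition: it is implied by [related] below,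
   hence holds for every Killing field. *)
Definition quot_field : Type := quot_space -> quot_tangent.

Implicit Types (X : quot_field) (Y : 'cV[R]_n -> 'cV[R]_n).
Implicit Types (c : R -> quot_space) (T S : R).

(* When G is discrete and acts freely, quot_proj is a local diffeomorphism and
   its local inverses are the charts of the quotient; in these charts, a field X
   on the quotient is the field Y on R^n such that [related Y X]. *)
Definition related Y X : Prop :=
  forall x, X (quot_proj x) = tangent_proj (x, Y x).

(* The field on the quotient to which Y projects; it is meaningful only for a
   G-invariant Y, as in the next lemma. *)
Definition dproj Y : quot_field :=
  fun m => tangent_proj (repr m, Y (repr m)).

Lemma dproj_related Y :
  (forall g x, elts G g -> Y (act g x) = g.1 *m Y x) -> related Y (dproj Y).
Proof.
move=> Yinv x; apply/eqP; rewrite /dproj /tangent_proj /quot_proj.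
case: piP => y /eqP; rewrite eqmodE /= => /asboolP[g Gg ->].
rewrite eqmodE /=; apply: etrans (tangent_orbit_sym _ _) _.
by apply/asboolP; exists g; rewrite // /tangent_act /= Yinv.
Qed.

Definition killing X : Prop := exists2 Y, related Y X & euclidean_killing Y.

(* The condition 0 < l excludes the zero field. *)
Definition constant_length X : Prop :=
  exists2 l, 0 < l & forall m, tnorm (X m) = l.

(* The equation c' = X (c), read in a chart around each c t. *)
Definition integral_curve X c : Prop :=
  forall t : R, exists gam : R -> 'cV[R]_n, \forall s \near t,
    [/\ derivable gam s 1, c s = quot_proj (gam s)
      & X (c s) = tangent_proj (gam s, derive1 gam s)].

Definition has_period c T : Prop := 0 < T /\ forall t, c (t + T) = c t.

Definition closed_curve c : Prop := exists T, has_period c T.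

Definition minimal_period c T : Prop :=
  has_period c T /\ forall S, has_period c S -> T <= S.

(* The length of an integral curve c of X, whose velocity is X (c t), over
   one period T. *)
Definition curve_length X c T : R :=
  Rintegral lebesgue_measure `[0, T] (fun t => tnorm (X (c t))).

Definition quasiregular X : Prop :=
  (forall c, integral_curve X c -> closed_curve c) /\
  exists c1 c2 T1 T2,
    [/\ integral_curve X c1, integral_curve X c2,
        minimal_period c1 T1, minimal_period c2 T2
      & curve_length X c1 T1 != curve_length X c2 T2].

Definition closed_and_nonclosed X : Prop :=
  (exists2 c, integral_curve X c & closed_curve c) /\
  (exists2 c, integral_curve X c & ~ closed_curve c).

Definition maximal_minimal_period X T : Prop :=
  (exists2 c, integral_curve X c & minimal_period c T) /\
  (forall c S, integral_curve X c -> minimal_period c S -> S <= T).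

(* Singular trajectories of a quasiregular field. *)
Definition singular_quasiregular X c : Prop :=
  integral_curve X c /\
  exists T Tmax,
    [/\ minimal_period c T, maximal_minimal_period X Tmax & T < Tmax].

(* Singular trajectories of a field with closed and non-closed trajectories. *)
Definition singular_mixed X c : Prop := integral_curve X c /\ closed_curve c.

Definition passes_through c (m : quot_space) : Prop := exists t, c t = m.

Definition screw_element (A : 'M[R]_n) (a b : 'cV[R]_n) : Prop :=
  [/\ elts G (A, (1%:M - A) *m b + a), a != 0, d_invariant G a, dot b a = 0
    & A != 1%:M].

End Quotient.

Arguments quot_proj {R n} G x.
Arguments tangent_proj {R n} G xv.
Arguments dproj {R n} G Y.

(* Main.v *)
Require Import Defs.
From mathcomp Require Import all_boot all_order all_algebra.
From mathcomp Require Import all_classical all_reals all_analysis.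
From mathcomp Require Import lra.
Set Implicit Arguments.
Unset Strict Implicit.
Unset Printing Implicit Defensive.
Import Order.TTheory GRing.Theory Num.Theory.
Import numFieldNormedType.Exports.
Local Open Scope classical_set_scope.
Local Open Scope ring_scope.

(** The fields in question are parallel: a Killing field Y on R^n satisfies
    <Y x - Y y, x - y> = 0, hence Z = Y - Y 0 is skew for the inner product,
    and evaluating a constant |Y|^2 at x, -x and 0 leaves 2 |Z x|^2 = 0
    ([killing_const_norm]). On the quotient, a Killing field of constant
    length is therefore the projection of a constant field w <> 0, and w is
    invariant under the linear parts of G ([const_length_killing_parallel]).

    Its integral curves are the projected lines t |-> p (x + t w)
    ([integral_curve_line]), and such a line has period T exactly when some
    g in G moves x to x + T w ([line_curve_period]), that is, when G
    contains the screw motion (A, (I - A) x + T w) for some A. Everything is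
    thus a question about which screw motions along w lie in G.

    Discreteness enters three times. A bounded part of an orbit comes from
    finitely many elements of G ([finite_orbit_bounded]), so a closed line
    has a minimal period ([closed_line_minimal_period]). By the same
    finiteness, once G contains a translation along w, every screw motion of
    G along w has a rotation of finite order: otherwise its powers, brought
    back by the translation, would be infinitely many elements moving its
    axis by a bounded amount ([translation_finite_order]). Lastly G is
    countable, so some point x lies on the axis of no proper screw motion
    along w, and the line through x can be closed only by a translation
    ([generic_point]).

    A screw motion with rotation A <> I of finite order has a power which is
    a translation, so all lines close up; the generic line has the largest
    period T0, and the axis of the screw has a smaller one, since otherwise
    dividing out the translation T0 w would leave a nontrivial rotation of G
    with a fixed point ([finite_screw_quasiregular]). A rotation of infinite
    order rules out translations along w, so the generic line is not closed
    whereas the axis is ([infinite_screw_mixed]). Conversely, a closed line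
    that is shorter than another one, or that coexists with a line which is
    not closed, cannot be closed by a translation, so it is closed by a
    proper screw ([quasiregular_finite_screw], [mixed_infinite_screw]);
    moving the base point along w makes it orthogonal to w
    ([screw_element_recenter]). *)

(** * The Euclidean inner product *)

Section DotProduct.
Context {R : realType} {n : nat}.
Implicit Types (A : 'M[R]_n) (u v w x y : 'cV[R]_n) (k : R).

Lemma dotE u v : dot u v = (u^T *m v) 0 0.
Proof. by rewrite mxE; apply: eq_bigr => i _; rewrite mxE. Qed.

Lemma dotC u v : dot u v = dot v u.
Proof. by apply: eq_bigr => i _; rewrite mulrC. Qed.

Lemma dotDl u v w : dot (u + v) w = dot u w + dot v w.
Proof. by rewrite !dotE linearD mulmxDl mxE. Qed.

Lemma dotZl k u v : dot (k *: u) v = k * dot u v.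
Proof. by rewrite !dotE linearZ -scalemxAl mxE. Qed.

Lemma dotNl u v : dot (- u) v = - dot u v.
Proof. by rewrite -scaleN1r dotZl mulN1r. Qed.

Lemma dotBl u v w : dot (u - v) w = dot u w - dot v w.
Proof. by rewrite dotDl dotNl. Qed.

Lemma dotDr u v w : dot u (v + w) = dot u v + dot u w.
Proof. by rewrite !(dotC u) dotDl. Qed.

Lemma dotZr k u v : dot u (k *: v) = k * dot u v.
Proof. by rewrite !(dotC u) dotZl. Qed.

Lemma dotNr u v : dot u (- v) = - dot u v.
Proof. by rewrite !(dotC u) dotNl. Qed.

Lemma dotBr u v w : dot u (v - w) = dot u v - dot u w.
Proof. by rewrite !(dotC u) dotBl. Qed.

Lemma dot0l v : dot 0 v = 0 :> R.
Proof. by rewrite -(subrr v) dotBl subrr. Qed.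

Lemma dot_ge0 u : 0 <= dot u u.
Proof. by apply: sumr_ge0 => i _; rewrite -expr2 sqr_ge0. Qed.

Lemma dot_eq0 u : dot u u = 0 -> u = 0.
Proof.
move=> /eqP; rewrite psumr_eq0 => [/allP u0|i _]; last first.
  by rewrite -expr2 sqr_ge0.
apply/colP => i; rewrite mxE.
by have := u0 i (mem_index_enum i); rewrite mulf_eq0 orbb => /eqP.
Qed.

Lemma dot_gt0 u : u != 0 -> 0 < dot u u.
Proof.
by move=> u0; rewrite lt_def dot_ge0 andbT; apply: contra_neq u0 => /dot_eq0.
Qed.

Lemma eq_dot u v : (forall w, dot u w = dot v w) -> u = v.
Proof.
move=> uv; apply/eqP; rewrite -subr_eq0; apply/eqP/dot_eq0.
by rewrite dotBl uv subrr.
Qed.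

Lemma orthogonal_unit A : orthogonal_mx A -> A \in unitmx.
Proof. by case/mulmx1_unit. Qed.

Lemma dot_orthogonal A u v : orthogonal_mx A -> dot (A *m u) (A *m v) = dot u v.
Proof. by move=> oA; rewrite !dotE trmx_mul mulmxA -(mulmxA u^T) oA mulmx1. Qed.

Lemma orthogonal_entry_le1 A i j : orthogonal_mx A -> `|A i j| <= 1.
Proof.
move=> oA; rewrite -(expr_le1 (n := 2)) // real_normK ?num_real // expr2.
have <- : \sum_k A k j * A k j = 1.
  have /matrixP/(_ j j) := oA; rewrite !mxE eqxx => oAj; rewrite -[RHS]oAj.
  by apply: eq_bigr => k _; rewrite mxE.
by rewrite (bigD1 i) //= lerDl sumr_ge0 // => k _; rewrite -expr2 sqr_ge0.
Qed.

End DotProduct.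

(** * Derivatives of curves and fields *)

Section Analysis.
Context {R : realType} {n : nat}.
Implicit Types (u v w x y : 'cV[R]_n) (Y : 'cV[R]_n -> 'cV[R]_n).

Lemma entry_le_norm v i : `|v i 0| <= `|v|.
Proof.
by rewrite [leRHS]/Num.Def.normr /= mx_normrE (le_bigmax _ _ (i, 0)).
Qed.

Lemma is_derive_dot (f : R -> 'cV[R]_n) df u (t : R) :
  is_derive t (1 : R) f df ->
  is_derive t (1 : R) (fun s => dot (f s) u) (dot df u).
Proof.
move=> [fd fE]; have fdi := (derivable_mxP _ _ _).1 fd.
have -> : (fun s => dot (f s) u) = \sum_i (u i 0 \*: (fun s => f s i 0)).
  apply/funext => s; rewrite fct_sumE; apply: eq_bigr => i _.
  by rewrite /= mulrC.
have di i :
    is_derive t (1 : R) (u i 0 \*: (fun s => f s i 0)) (u i 0 *: df i 0).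
  apply: is_deriveZ; apply: DeriveDef (fdi i 0) _.
  by rewrite -fE derive_mx // mxE.
apply: (is_derive_eq (is_derive_sum di)).
by apply: eq_bigr => i _; rewrite /GRing.scale /= mulrC.
Qed.

Lemma is_derive_line Y y v (t : R) :
  derivable Y (t *: v + y) v ->
  is_derive t (1 : R) (fun s : R => Y (s *: v + y)) ('D_v Y (t *: v + y)).
Proof.
have E : (fun h : R => h^-1 *:
            (((fun s : R => Y (s *: v + y)) \o shift t) (h *: 1)
             - Y (t *: v + y)))
       = (fun h : R => h^-1 *:
            ((Y \o shift (t *: v + y)) (h *: v) - Y (t *: v + y))).
  by apply/funext => h; rewrite /= [_%:A]mulr1 scalerDl addrA.
by move=> dY; apply: DeriveDef; rewrite /derivable /derive E.
Qed.

Lemma derive0_const_near (f : R -> R) (t e : R) :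
  (forall s : R, `|t - s| < e -> is_derive s (1 : R) f 0) ->
  forall s, `|t - s| < e -> f s = f t.
Proof.
suff H (a b : R) : a <= b ->
    (forall s : R, a <= s <= b -> is_derive s (1 : R) f 0) -> f b = f a.
  move=> fd s ts; case: (leP s t) => [st|/ltW st].
    apply/esym/H => // r /andP[sr rt]; apply: fd; apply: le_lt_trans ts.
    by rewrite !ger0_norm ?subr_ge0 // lerD2l lerN2.
  apply: H => // r /andP[tr rs]; apply: fd; apply: le_lt_trans ts.
  by rewrite !ler0_norm ?subr_le0 // !opprB lerD2r.
move=> ab fd; have [s sab|s|c _] := @MVT_segment R f (cst 0) a b ab.
- by apply: fd; rewrite !ltW ?(itvP sab).
- apply: derivable_within_continuous => r; rewrite in_itv /= => rab.
  by case: (fd r rab).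
by rewrite mul0r => /eqP; rewrite subr_eq0 => /eqP.
Qed.

(** Paired with any vector w, the curve f s - s *: a becomes a real function
    with zero derivative on a ball around t. *)
Lemma derive_const_affine_near (f : R -> 'cV[R]_n) a (t : R) :
  (\forall s \near t, derivable f s (1 : R) /\ derive1 f s = a) ->
  exists x, \forall s \near t, f s = x + s *: a.
Proof.
move=> /nbhs_ballP[e e0 fe]; exists (f t - t *: a).
apply/nbhs_ballP; exists e => // s ts; apply: eq_dot => w.
have dlin (r : R) : is_derive r (1 : R) (fun r : R => r * dot a w) (dot a w).
  have -> : (fun r : R => r * dot a w) = dot a w \*: id.
    by apply/funext => r'; rewrite /= mulrC.
  by rewrite -[X in is_derive _ _ _ X]mulr1; apply: is_deriveZ.
have H : dot (f s) w - s * dot a w = dot (f t) w - t * dot a w.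
  apply: (@derive0_const_near (fun r => dot (f r) w - r * dot a w) t e) => //.
  move=> r tr.
  have [fd fa] := fe r tr; rewrite derive1E in fa.
  apply: is_derive_eq (subrr (dot a w)).
  by apply: is_deriveB; apply: is_derive_dot; rewrite -fa; apply: derivableP.
by rewrite dotDl dotBl !dotZl -H subrK.
Qed.

End Analysis.

(** * Killing fields of constant length on Euclidean space *)

Section ParallelFields.
Context {R : realType} {n : nat}.
Implicit Types (w x y : 'cV[R]_n) (Y : 'cV[R]_n -> 'cV[R]_n).

(** Along the segment from y to x the function <Y, x - y> is constant, since
    the Killing equation, taken twice in the direction x - y, kills its
    derivative. *)
Lemma killing_dotB Y x y : euclidean_killing Y -> dot (Y x - Y y) (x - y) = 0.
Proof.
move=> [/(_ 1)[dY _] kY]; set v := x - y.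
have dline s : is_derive s (1 : R) (fun s : R => dot (Y (s *: v + y)) v) 0.
  apply: (is_derive_eq (is_derive_dot _ _)).
    by apply: is_derive_line; apply: diff_derivable; apply: dY.
  apply/eqP; have := kY (s *: v + y) v v.
  by rewrite /lie_metric (dotC v) => /eqP; rewrite -mulr2n mulrn_eq0.
have := is_derive_0_is_cst 1 0 dline.
by rewrite scale1r scale0r add0r /v subrK dotBl => ->; rewrite subrr.
Qed.

(** Polarizing [killing_dotB] makes Z = Y - Y 0 skew, hence odd, and the
    constancy of |Z + Y 0|^2 at x and -x gives |Z x|^2 + 2 <Z x, Y 0> = 0
    and |Z x|^2 - 2 <Z x, Y 0> = 0. *)
Lemma killing_const_norm Y l :
    euclidean_killing Y -> (forall x, dot (Y x) (Y x) = l) ->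
  Y = affine_field 0 (Y 0).
Proof.
move=> kY normY; pose Z x := Y x - Y 0.
have ZE x : Z x = Y x - Y 0 by [].
have Zx x : dot (Z x) x = 0.
  by have := killing_dotB x 0 kY; rewrite subr0.
clearbody Z.
have skewZ x y : dot (Z x) y = - dot (Z y) x.
  have := killing_dotB x y kY.
  have -> : Y x - Y y = Z x - Z y by rewrite !ZE opprB addrA subrK.
  by rewrite dotBl !dotBr !Zx; lra.
have oddZ x : Z (- x) = - Z x.
  by apply: eq_dot => w; rewrite skewZ dotNr opprK dotNl skewZ.
have dotY x : dot (Z x) (Z x) + 2 * dot (Z x) (Y 0) + dot (Y 0) (Y 0) = l.
  have YE : Y x = Z x + Y 0 by rewrite ZE subrK.
  by rewrite -(normY x) YE dotDl !dotDr (dotC (Y 0) (Z x)); lra.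
apply/funext => x; rewrite /affine_field mul0mx add0r; apply/eqP.
rewrite -subr_eq0 -ZE; apply/eqP/dot_eq0.
have := dotY x; have := dotY (- x); have := normY 0.
by rewrite oddZ !dotNl dotNr; lra.
Qed.

Lemma affine_field0 w : affine_field 0 w = cst w.
Proof. by apply/funext => x; rewrite /affine_field mul0mx add0r. Qed.

Lemma parallel_killing w : euclidean_killing (affine_field 0 w).
Proof.
rewrite affine_field0; split=> [k|x u v]; last first.
  by rewrite /lie_metric !derive_cst dot0l dotC dot0l addr0.
elim: k w => [|k IHk] w /=; first by move=> x; apply: cst_continuous.
split=> [x|v]; first exact: differentiable_cst.
have -> : 'D_v (cst w) = cst 0 by apply/funext => x; exact: derive_cst.
exact: IHk.
Qed.

End ParallelFields.

(** * Parallel fields on the quotient and their integral curves *)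

Section ConnectedLine.
Context {R : realType}.

(** The truth set of P is open and closed in the connected line. *)
Lemma locally_constant_prop (P : R -> Prop) (t0 : R) :
  (forall t, \forall s \near t, P s <-> P t) -> P t0 -> forall t, P t.
Proof.
move=> Ploc Pt0; have openP : open [set t | P t].
  rewrite openE => t Pt; apply: filterS (Ploc t) => s [_]; exact.
have openNP : open [set t | ~ P t].
  rewrite openE => t nPt; apply: filterS (Ploc t) => s [Pst _] Ps.
  exact/nPt/Pst.
have cR : connected [set: R] by apply/connected_intervalP.
have PT : [set t | P t] = setT.
  apply: cR; first by exists t0.
    by exists [set t | P t]; rewrite ?setTI.
  exists [set t | P t]; rewrite ?setTI //.
  by rewrite -[X in closed X]setCK closedC.
by move=> t; have : [set: R] t by []; rewrite -PT.
Qed.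

End ConnectedLine.

Section QuotientFields.
Context {R : realType} {n : nat} (G : isom_group R n).
Implicit Types (a w x y : 'cV[R]_n) (Y : 'cV[R]_n -> 'cV[R]_n).
Implicit Types (X : quot_field G) (c : R -> quot_space G).

Lemma quot_proj_eq x y :
  quot_proj G x = quot_proj G y <-> exists2 g, elts G g & act g x = y.
Proof.
rewrite /quot_proj; split=> [/eqP|[g Gg gx]]; last apply/eqP.
  by rewrite eqmodE /= => /asboolP[g Gg ->]; exists g.
by rewrite eqmodE /=; apply/asboolP; exists g.
Qed.

Lemma tangent_proj_eq xv yw :
  tangent_proj G xv = tangent_proj G yw <->
  exists2 g, elts G g & tangent_act g xv = yw.
Proof.
rewrite /tangent_proj; split=> [/eqP|[g Gg gx]]; last apply/eqP.
  by rewrite eqmodE /= => /asboolP[g Gg ->]; exists g.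
by rewrite eqmodE /=; apply/asboolP; exists g.
Qed.

Lemma quot_proj_surj m : exists x, m = quot_proj G x.
Proof. by exists (repr m); rewrite /quot_proj reprK. Qed.

Lemma act_inv g x : elts G g -> act (isom_inv g) (act g x) = x.
Proof. by move=> Gg; have [] := tangent_actK (x, 0) Gg. Qed.

Lemma actI g h x : acts_freely G -> elts G g -> elts G h ->
  act g x = act h x -> g = h.
Proof.
move=> free Gg Gh gh.
have U : h.1 \in unitmx by apply/orthogonal_unit/(isom_orthogonal Gh).
have /(congr1 (isom_mul h)) : isom_mul (isom_inv h) g = (1%:M, 0).
  apply: (free _ x); first by apply: isom_groupM => //; apply: isom_groupV.
  by rewrite act_mul gh act_inv.
case: g h U {gh Gg Gh} => [A c] [B e] /= U.
rewrite /isom_mul /= mulmx1 mulmx0 add0r mulmxA mulmxDr mulmxN !mulmxA.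
by rewrite mulmxV // !mul1mx subrK.
Qed.

Lemma related_dproj X Y : related Y X -> X = dproj G Y.
Proof.
move=> XY; apply/funext => m; rewrite /dproj -XY.
by rewrite /quot_proj reprK.
Qed.

(** The points 0 and g 0 have the same image, so some h in G carries the
    vector a at 0 to the vector a at g 0; freeness forces h = g, so g.1
    fixes a. *)
Lemma related_parallel_invariant X a :
  acts_freely G -> related (affine_field 0 a) X -> d_invariant G a.
Proof.
move=> free XY g Gg; rewrite affine_field0 in XY.
have : tangent_proj G (0, a) = tangent_proj G (act g 0, a).
  rewrite -(XY 0) -(XY (act g 0)); congr X; apply/quot_proj_eq.
  by exists g.
move=> /tangent_proj_eq[h Gh [/= hg]].
by rewrite (actI free Gh Gg hg).
Qed.

Lemma related_parallel a :
  d_invariant G a -> related (affine_field 0 a) (dproj G (affine_field 0 a)).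
Proof.
by move=> inva; apply: dproj_related => g x Gg; rewrite affine_field0 /= inva.
Qed.

Lemma parallel_tnorm a x :
  d_invariant G a ->
  tnorm (dproj G (affine_field 0 a) (quot_proj G x)) = Num.sqrt (dot a a).
Proof.
by move=> inva; rewrite (related_parallel inva) affine_field0 tnormE.
Qed.

Lemma parallel_killing_const_length a : a != 0 -> d_invariant G a ->
  let X := dproj G (affine_field 0 a) in killing X /\ constant_length X.
Proof.
move=> a0 inva X; split.
  exists (affine_field 0 a); first exact: related_parallel.
  exact: parallel_killing.
exists (Num.sqrt (dot a a)); first by rewrite sqrtr_gt0 dot_gt0.
by move=> m; have [x ->] := quot_proj_surj m; rewrite parallel_tnorm.
Qed.

Lemma const_length_killing_parallel X :
    acts_freely G -> killing X -> constant_length X ->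
  exists a, [/\ a != 0, d_invariant G a & X = dproj G (affine_field 0 a)].
Proof.
move=> free [Y XY kY] [l l0 Xl].
have normY x : dot (Y x) (Y x) = l ^+ 2.
  by rewrite -(Xl (quot_proj G x)) XY tnormE sqr_sqrtr // dot_ge0.
have YE := killing_const_norm kY normY.
exists (Y 0); rewrite YE in XY; split; last exact: related_dproj.
  apply: contraTneq l0 => Y0; have := normY 0.
  by rewrite Y0 dot0l => /esym/eqP; rewrite sqrf_eq0 => /eqP ->; rewrite ltxx.
exact: related_parallel_invariant free XY.
Qed.

Definition line_curve a x (t : R) : quot_space G := quot_proj G (x + t *: a).

Lemma act_line g a x t : d_invariant G a -> elts G g ->
  act g (x + t *: a) = act g x + t *: a.
Proof. by move=> inva Gg; rewrite /act mulmxDr -scalemxAr inva // addrAC. Qed.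

Lemma line_curve_eq a x y s t : d_invariant G a ->
  line_curve a x s = line_curve a y s -> line_curve a x t = line_curve a y t.
Proof.
move=> inva /quot_proj_eq[g Gg]; rewrite act_line // => /addIr gx.
by apply/quot_proj_eq; exists g; rewrite // act_line // gx.
Qed.

Lemma line_curve_integral a x : d_invariant G a ->
  integral_curve (dproj G (affine_field 0 a)) (line_curve a x).
Proof.
move=> inva t; exists (fun s => x + s *: a); near=> s.
have ds : is_derive s (1 : R) (fun s : R => x + s *: a) a.
  have -> : (fun s : R => x + s *: a) = (fun s : R => id (s *: a + x)).
    by apply/funext => r; rewrite addrC.
  have := @is_derive_line R n id x a s; rewrite derive_id; apply.
  exact: derivable_id.
split; [by case: ds|by []|].
rewrite (related_parallel inva) affine_field0 derive1E.
congr (tangent_proj G (_, _)).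
by apply/esym/derive_val.
Unshelve. all: by end_near. Qed.

(** Near each time c is the projection of a line directed by a, but the
    lifted line depends on the time. Two projected lines agreeing at one
    time agree always ([line_curve_eq]), so the set of times where c follows
    the line starting at c 0 is locally constant. *)
Lemma integral_curve_line a c : d_invariant G a ->
    integral_curve (dproj G (affine_field 0 a)) c ->
  exists x, c = line_curve a x.
Proof.
move=> inva icc.
have loc (t : R) : exists x, \forall s \near t, c s = line_curve a x s.
  have [gam gamc] := icc t.
  have [|x xgam] := @derive_const_affine_near R n gam a t.
    apply: filterS gamc => s [dgam cs]; rewrite cs (related_parallel inva).
    move=> /tangent_proj_eq[g Gg [_ /=]].
    by rewrite affine_field0 /= inva.
  by exists x; apply: filterS2 gamc xgam => s [_ -> _] ->.
have [x0 c0] := quot_proj_surj (c 0); exists x0; apply/funext.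
apply: (locally_constant_prop _ (t0 := 0)) => [t|]; last first.
  by rewrite /line_curve scale0r addr0.
have [x cx] := loc t; have ct := nbhs_singleton cx.
by apply: filterS cx => s ->; rewrite ct; split; apply: line_curve_eq.
Qed.

Lemma line_curve_period a x T : d_invariant G a ->
  has_period (line_curve a x) T <->
  0 < T /\ exists2 g, elts G g & act g x = x + T *: a.
Proof.
move=> inva; split=> -[T0 per]; split=> //.
  have /esym := per 0; rewrite /line_curve add0r scale0r addr0.
  by move=> /quot_proj_eq.
case: per => g Gg gx t; apply/esym/quot_proj_eq; exists g => //.
by rewrite act_line // gx -addrA -scalerDl (addrC T).
Qed.

Lemma parallel_curve_length a c (T : R) : d_invariant G a -> 0 <= T ->
  curve_length (dproj G (affine_field 0 a)) c T = Num.sqrt (dot a a) * T.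
Proof.
move=> inva T0; rewrite /curve_length.
have -> : (fun t => tnorm (dproj G (affine_field 0 a) (c t)))
    = (fun=> Num.sqrt (dot a a)).
  apply/funext => t; have [x ->] := quot_proj_surj (c t).
  by rewrite parallel_tnorm.
rewrite Rintegral_cst //; congr (_ * _).
apply: (etrans (congr1 fine (lebesgue_measure_itv `[0, T]))) => /=.
move: T0; rewrite lte_fin le_eqVlt => /predU1P[<-|->].
  by rewrite ltxx.
by rewrite /= subr0.
Qed.

End QuotientFields.

(** * Discrete groups of isometries *)

Section Discreteness.
Context {R : realType} {n : nat} (G : isom_group R n).
Implicit Types (a b u w x y : 'cV[R]_n) (A : 'M[R]_n).

(** If the entries of g and h are close, then g^-1 h is close to the
    identity, which is isolated in G; this is uniform in g because the
    entries of an orthogonal matrix are at most 1 in absolute value. The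
    factor n.+1 absorbs the sum over one row. *)
Lemma discrete_separated : discrete_group G ->
  exists2 d : R, 0 < d & forall g h, elts G g -> elts G h ->
    (forall i j, `|g.1 i j - h.1 i j| < d) ->
    (forall i, `|g.2 i 0 - h.2 i 0| < d) -> g = h.
Proof.
move=> /(_ _ (isom_group1 G))[_ [V V1 VG]].
have {V1} [e /= e0 eV] := (nbhs_ballP _ _).1 V1.
exists (e / n.+1%:R) => [|g h Gg Gh gh1 gh2]; first by rewrite divr_gt0.
have invE : invmx g.1 = g.1^T.
  have oA := isom_orthogonal Gg; have U := orthogonal_unit oA.
  by rewrite -[LHS]mul1mx -oA mulmxK.
have bound (f : 'I_n -> R) i : (forall k, `|f k| < e / n.+1%:R) ->
    `|\sum_k g.1 k i * f k| < e.
  move=> fe; apply: (@le_lt_trans _ _ (\sum_(k < n) e / n.+1%:R)).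
    apply: le_trans (ler_norm_sum _ _ _) _; apply: ler_sum => k _.
    rewrite normrM -[leRHS]mul1r ler_pM // ?(ltW (fe k)) //.
    exact/orthogonal_entry_le1/(isom_orthogonal Gg).
  rewrite sumr_const card_ord -[ltLHS]mulr_natr mulrAC -mulrA gtr_pMr //.
  by rewrite ltr_pdivrMr // mul1r ltr_nat.
have : (V `&` elts G) (isom_mul (isom_inv g) h).
  split; last by apply: isom_groupM => //; apply: isom_groupV.
  apply: eV; split; split=> // i j; rewrite /ball /= invE.
    rewrite -(isom_orthogonal Gg) -opprB normrN !mxE -sumrB.
    under eq_bigr => k _ do rewrite !mxE -mulrBr.
    apply: (bound (fun k => h.1 k j - g.1 k j)) => k.
    by rewrite distrC.
  rewrite ord1 -opprB normrN !mxE subr0 -sumrB.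
  under eq_bigr => k _ do rewrite !mxE -mulrBr.
  apply: (bound (fun k => h.2 k 0 - g.2 k 0)) => k.
  by rewrite distrC.
rewrite VG /= => gh.
have U := orthogonal_unit (isom_orthogonal Gg).
have /(congr1 (isom_mul g)) := gh.
case: g h U {Gg Gh gh1 gh2 invE bound gh} => [A c] [B k] /= U.
rewrite /isom_mul /= mulmx1 mulmx0 add0r mulmxA mulmxDr mulmxN !mulmxA.
by rewrite mulmxV // !mul1mx subrK => ->.
Qed.

(** Two points of the same cell of a grid of mesh d are closer than d; the
    shift by M makes truncation act as a floor. *)
Lemma truncn_grid_near (d M r s : R) : 0 < d -> - M <= r -> - M <= s ->
  Num.truncn ((r + M) / d) = Num.truncn ((s + M) / d) -> `|r - s| < d.
Proof.
move=> d0 Mr Ms rs; set k := Num.truncn ((r + M) / d) in rs.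
have grid q : - M <= q -> Num.truncn ((q + M) / d) = k ->
    k%:R * d <= q + M < (k%:R + 1) * d.
  move=> Mq <-; have /truncn_itv : 0 <= (q + M) / d.
    by rewrite divr_ge0 ?(ltW d0) // -lerBlDr sub0r.
  by rewrite -[_.+1]addn1 natrD ler_pdivlMr // ltr_pdivrMr.
have /andP[r1 r2] := grid r Mr erefl; have /andP[s1 s2] := grid s Ms (esym rs).
by rewrite ltr_norml; apply/andP; split; lra.
Qed.

(** Proper discontinuity. The bound on g x bounds the translation part of g,
    the linear part being bounded anyway; sorting all entries into the cells
    of a grid finer than the separation of G is then injective, with
    finitely many cells. *)
Lemma finite_orbit_bounded x N : discrete_group G ->
  finite_set [set g | elts G g /\ `|act g x| <= N].
Proof.
move=> /discrete_separated[d d0 sep].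
(* large enough for the linear part, through 1, and for the translation part *)
pose M := 1 + (`|N| + \sum_j `|x j 0|).
have sum_ge0 : 0 <= \sum_j `|x j 0| by apply: sumr_ge0.
have bnd1 g i j : elts G g -> `|g.1 i j| <= M.
  move=> Gg; apply: le_trans (orthogonal_entry_le1 _ _ (isom_orthogonal Gg)) _.
  by rewrite lerDl addr_ge0.
have bnd2 g i : elts G g -> `|act g x| <= N -> `|g.2 i 0| <= M.
  move=> Gg gxN; have -> : g.2 i 0 = act g x i 0 - (g.1 *m x) i 0.
    by rewrite /act mxE addrAC subrr add0r.
  apply: le_trans (ler_normB _ _) _; rewrite /M.
  have : `|act g x i 0| <= `|N|.
    by apply: le_trans (entry_le_norm _ _) (le_trans gxN (ler_norm _)).
  have : `|(g.1 *m x) i 0| <= \sum_j `|x j 0|.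
    rewrite mxE; apply: le_trans (ler_norm_sum _ _ _) _; apply: ler_sum => j _.
    rewrite normrM ler_piMl //.
    exact: orthogonal_entry_le1 (isom_orthogonal Gg).
  lra.
pose K := Num.truncn ((M + M) / d).
pose cell (r : R) : 'I_K.+1 := inord (Num.truncn ((r + M) / d)).
have cell_near r s : `|r| <= M -> `|s| <= M -> cell r = cell s -> `|r - s| < d.
  move=> rM sM rs; apply: (truncn_grid_near (M := M) d0).
  - by move: rM; rewrite ler_norml => /andP[].
  - by move: sM; rewrite ler_norml => /andP[].
  have trK q : `|q| <= M -> (Num.truncn ((q + M) / d) < K.+1)%N.
    rewrite ltnS ler_norml => /andP[_ qM]; apply: le_truncn.
    by rewrite ler_pM2r ?invr_gt0 // lerD2r.
  by have := congr1 val rs; rewrite /= !inordK ?trK.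
pose code (g : 'M[R]_n * 'cV[R]_n) := (map_mx cell g.1, map_mx cell g.2).
have codeI : {in [set g | elts G g /\ `|act g x| <= N] &, injective code}.
  move=> g h; rewrite !inE => -[Gg gN] [Gh hN] [/matrixP gh1 /matrixP gh2].
  apply: sep => // [i j|i]; apply: cell_near; rewrite ?bnd1 ?bnd2 //.
    by have := gh1 i j; rewrite !mxE.
  by have := gh2 i 0; rewrite !mxE.
rewrite -(eq_finite_set (inj_card_eq codeI)).
exact: finite_finset.
Qed.

Lemma discrete_countable : discrete_group G -> countable (elts G).
Proof.
move=> dG; apply: (@sub_countable _ _ _
  (\bigcup_(N : nat) [set g | elts G g /\ `|act g 0| <= N%:R])).
  apply: subset_card_le => g Gg; exists (Num.bound `|act g 0|) => //=.
  split=> //.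
  by apply/ltW/archi_boundP.
apply: bigcup_countable => // N _; apply: finite_set_countable.
exact: finite_orbit_bounded.
Qed.

End Discreteness.

(** * Screw motions in the group *)

Section Screws.
Context {R : realType} {n : nat} (G : isom_group R n).
Implicit Types (a b u v w x y : 'cV[R]_n) (A : 'M[R]_n) (r s t T : R).

(** The isometry with linear part A that carries b to b + u: when A fixes u,
    it is the rotation A about b followed by the translation by u. *)
Definition screw A b u : 'M[R]_n * 'cV[R]_n := (A, (1%:M - A) *m b + u).

Lemma act_screw A b u : act (screw A b u) b = b + u.
Proof. by rewrite /act /= mulmxBl mul1mx addrA (addrC (A *m b)) subrK. Qed.

Lemma act_screw_id b u x : act (screw 1%:M b u) x = x + u.
Proof. by rewrite /act /= subrr mul0mx mul1mx add0r. Qed.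

Lemma screw_mul A B b u w : A *m w = w ->
  isom_mul (screw A b u) (screw B b w) = screw (A *m B) b (u + w).
Proof.
move=> Aw; rewrite /isom_mul /screw /= mulmxDr Aw mulmxA; congr (_, _).
have -> : 1%:M - A *m B = A *m (1%:M - B) + (1%:M - A).
  by rewrite mulmxBr mulmx1 [RHS]addrC addrA subrK.
by rewrite [in RHS]mulmxDl addrACA (addrC w).
Qed.

Lemma act_screwP g x u : act g x = x + u <-> g = screw g.1 x u.
Proof.
split=> [|->]; last exact: act_screw.
case: g => [A c]; rewrite /act /screw /= mulmxBl mul1mx => gx.
congr pair; apply: (addrI (A *m x)); rewrite gx [in RHS]addrA.
by rewrite [A *m x + _]addrC subrK.
Qed.

Lemma screw_exp A b u k : elts G (screw A b u) -> A *m u = u ->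
  elts G (screw (A ^+ k) b (k%:R *: u)).
Proof.
move=> Gs Au; elim: k => [|k IHk].
  by rewrite expr0 scale0r /screw subrr mul0mx addr0; apply: isom_group1.
have Aku : A *m (k%:R *: u) = k%:R *: u by rewrite -scalemxAr Au.
have := isom_groupM Gs IHk; rewrite screw_mul //.
by rewrite exprS mulmxE -natr1 scalerDl scale1r [u + _]addrC.
Qed.

Lemma screw_subM A b u v m :
    elts G (screw A b u) -> elts G (screw 1%:M b v) -> A *m v = v ->
  elts G (screw A b (u - m%:R *: v)).
Proof.
move=> Gu Gv Av; have GNv : elts G (screw 1%:M b (- v)).
  have := isom_groupV Gv; rewrite /isom_inv /screw /= subrr !mul0mx !add0r.
  by rewrite invmx1 mul1mx.
have := isom_groupM Gu (screw_exp m GNv (mul1mx _)).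
rewrite screw_mul; last by rewrite -scalemxAr mulmxN Av.
by rewrite expr1n mulmx1 scalerN.
Qed.

(** The k-th power of the screw, composed with a suitable power of the
    translation, is the screw with rotation A^k and a translation part r k
    *: a with 0 <= r k <= T. All of them move b by a bounded amount, so two
    of them coincide, and with them two powers of A. *)
Lemma translation_finite_order A a b s T :
    discrete_group G -> d_invariant G a ->
    0 < T -> elts G (screw 1%:M b (T *: a)) ->
    0 <= s -> elts G (screw A b (s *: a)) ->
  finite_order A.
Proof.
move=> dG inva T0 GT s0 Gs.
pose m k := Num.truncn (k%:R * s / T).
pose r k := k%:R * s - (m k)%:R * T.
have rT k : 0 <= r k <= T.
  have /truncn_itv/andP[] : 0 <= k%:R * s / T.
    by rewrite divr_ge0 ?mulr_ge0 // ltW.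
  rewrite -/(m k) ler_pdivlMr // ltr_pdivrMr // -natr1 /r; lra.
have Gk k : elts G (screw (A ^+ k) b (r k *: a)).
  have Asa : A *m (s *: a) = s *: a.
    by rewrite -scalemxAr (inva _ Gs : A *m a = a).
  have Gp := screw_exp k Gs Asa.
  have Aka : A ^+ k *m a = a := inva _ Gp.
  have := screw_subM (m k) Gp GT; rewrite -scalemxAr Aka !scalerA -scalerBl.
  exact.
have [fin|] := pselect (exists k l, (k < l)%N /\ A ^+ k = A ^+ l).
  have [k [l [kl Akl]]] := fin; exists (l - k)%N; first by rewrite subn_gt0.
  have U : A ^+ k \in unitmx := orthogonal_unit (isom_orthogonal (Gk k)).
  by apply: (can_inj (mulKmx U)); rewrite mulmx1 mulmxE -exprD subnKC // ltnW.
move=> inj; exfalso; apply: infinite_nat.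
have powI : {in [set: nat] &, injective (fun k => screw (A ^+ k) b (r k *: a))}.
  move=> k l _ _ [Akl _]; apply/eqP; apply: contra_notT inj.
  by rewrite neq_ltn => /orP[kl|lk]; [exists k, l|exists l, k].
rewrite -(eq_finite_set (inj_card_eq powI)).
apply: sub_finite_set (finite_orbit_bounded b (`|b| + T * `|a|) dG).
move=> g /= [k _ <-]; split; first exact: Gk.
have /andP[r0 rkT] := rT k.
rewrite act_screw (le_trans (ler_normD _ _)) // lerD2l normrZ ler_wpM2r //.
by rewrite ger0_norm.
Qed.

(** The periods below a given period T come from group elements moving x by
    at most T |a|, of which there are finitely many. *)
Lemma closed_line_minimal_period a x T :
    discrete_group G -> a != 0 -> d_invariant G a ->
  has_period (line_curve G a x) T ->
  exists T0, minimal_period (line_curve G a x) T0.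
Proof.
move=> dG a0 inva perT.
pose P := [set S | has_period (line_curve G a x) S /\ S <= T].
have finP : finite_set P.
  pose f (g : 'M[R]_n * 'cV[R]_n) := dot (act g x - x) a / dot a a.
  apply: (@sub_finite_set _ _
    (f @` [set g | elts G g /\ `|act g x| <= `|x| + T * `|a|])).
    move=> S [/(line_curve_period _ _ inva)[S0 [g Gg gx]] ST].
    exists g; last first.
      by rewrite /f gx addrC addKr dotZl mulfK // gt_eqF ?dot_gt0.
    split=> //; rewrite gx (le_trans (ler_normD _ _)) // lerD2l normrZ.
    rewrite ler_wpM2r //.
    by rewrite gtr0_norm.
  exact/finite_image/finite_orbit_bounded.
have min_seq (s : seq R) : s != [::] ->
    exists2 m, m \in s & {in s, forall r, m <= r}.
  elim: s => // q [|z s] IHs _.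
    by exists q; rewrite ?inE // => r; rewrite inE => /eqP ->.
  have [//|m ms mle] := IHs.
  exists (Num.min q m).
    by rewrite minEle; case: ifP; rewrite inE ?eqxx // ms orbT.
  move=> r; rewrite inE => /predU1P[->|/mle mr]; first by rewrite ge_min lexx.
  by rewrite ge_min mr orbT.
have [s Ps] := (finite_seqP _).1 finP.
have PT : P T by split.
have [|m] := min_seq s; first by apply: contraPneq PT => s0; rewrite Ps s0.
have sP r : (r \in s) = `[< P r >] by rewrite Ps; apply/idP/asboolP.
rewrite sP => /asboolP[perm mT] mle; exists m; split=> // S perS.
have [ST|TS] := leP S T; first by apply: mle; rewrite sP; apply/asboolP.
exact: le_trans mT (ltW TS).
Qed.

Lemma finite_roots (p : {poly R}) : p != 0 -> finite_set [set t | root p t].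
Proof.
move=> p0; apply: contrapT => /(infinite_set_fset (size p))[B Bp].
rewrite leqNgt => /negP; apply; apply: max_poly_roots p0 _ (finmap.fset_uniq B).
by apply/allP => t tB; apply: Bp.
Qed.

(** For g with linear part A <> I, the points x with g x - x parallel to a
    lie in a proper affine subspace: the multiple of a is determined by g,
    so a nonzero row of A - I gives a nontrivial linear equation on x. A
    countable union of proper affine subspaces does not cover the moment
    curve t |-> (t, t^2, ..., t^n), which meets each of them in finitely
    many points. *)
Lemma generic_point a : discrete_group G -> a != 0 -> d_invariant G a ->
  exists x, forall g T, elts G g -> act g x = x + T *: a -> g.1 = 1%:M.
Proof.
move=> dG a0 inva.
pose mom t : 'cV[R]_n := \col_j t ^+ j.+1.
pose bad g := [set t | g.1 != 1%:M /\ exists T, act g (mom t) = mom t + T *: a].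
have finbad g : elts G g -> finite_set (bad g).
  move=> Gg; have [g1|g1] := eqVneq g.1 1%:M.
    apply: sub_finite_set (finite_set0 R) => t [/=].
    by rewrite g1 eqxx.
  pose D := g.1 - 1%:M.
  have /matrix0Pn[i [j Dij]] : D != 0 by rewrite subr_eq0.
  (* right-hand side of row i of (A - I) x = T *: a - c, T being eliminated *)
  pose kap := dot g.2 a / dot a a * a i 0 - g.2 i 0.
  pose p := \sum_j D i j *: 'X^(j.+1) - kap%:P.
  have p0 : p != 0.
    apply: contraNneq Dij => /(congr1 (fun q : {poly R} => q`_j.+1)).
    rewrite coefB coefC subr0 coef0 coef_sum (bigD1 j) //= big1 => [|k kj].
      by rewrite addr0 coefZ coefXn eqxx mulr1 => ->.
    rewrite coefZ coefXn eqSS eq_sym (negPf kj : (k == j :> nat) = false).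
    by rewrite mulr0.
  apply: sub_finite_set (finite_roots p0) => t [/= _ [T gT]].
  have aa : dot a a != 0 by rewrite gt_eqF ?dot_gt0.
  (* pairing g x = x + T *: a with a eliminates x, since g.1 fixes a *)
  have TE : dot g.2 a / dot a a = T.
    have := congr1 (fun v => dot v a) gT; rewrite /act !dotDl dotZl.
    rewrite -{1}(inva g Gg) (dot_orthogonal _ _ (isom_orthogonal Gg)).
    by move=> /addrI ->; rewrite mulfK.
  have Dm : (D *m mom t) i 0 = kap.
    rewrite /D mulmxBl mul1mx /kap TE.
    have := congr1 (fun v : 'cV[R]_n => v i 0) gT.
    by rewrite /act !mxE; lra.
  rewrite /root /p hornerD hornerN hornerC -Dm horner_sum mxE subr_eq0.
  by apply/eqP/eq_bigr => k _; rewrite hornerZ hornerXn [mom t _ _]mxE.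
have cbad : countable (\bigcup_(g in elts G) bad g).
  apply: bigcup_countable => [|g Gg]; first exact: discrete_countable.
  exact/finite_set_countable/finbad.
have [t nbad] : exists t, ~ (\bigcup_(g in elts G) bad g) t.
  apply/existsNP => allbad.
  have : lebesgue_measure (`[0, 1] : set R) = 0%E.
    apply: countable_lebesgue_measure0; apply: sub_countable cbad.
    exact: subset_card_le.
  rewrite lebesgue_measure_itv /= lte_fin ltr01 -EFinB subr0 => -[] /eqP.
  by rewrite oner_eq0.
exists (mom t) => g T Gg gT; apply/eqP/negP => /negP g1.
by apply: nbad; exists g => //; split=> //; exists T.
Qed.

End Screws.

(** * Closed and singular trajectories of parallel fields *)

Section ParallelFlows.
Context {R : realType} {n : nat} (G : isom_group R n).
Hypotheses (discreteG : discrete_group G) (freeG : acts_freely G).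
Implicit Types (a b u v w x y : 'cV[R]_n) (A : 'M[R]_n) (r s t T : R).

Local Notation field w := (dproj G (affine_field 0 w)).
Local Notation line := (line_curve G).

Lemma translation_has_period w b x T : d_invariant G w -> 0 < T ->
  elts G (screw 1%:M b (T *: w)) -> has_period (line w x) T.
Proof.
move=> invw T0 GT; apply/line_curve_period => //; split=> //.
by exists (screw 1%:M b (T *: w)); rewrite // act_screw_id.
Qed.

Lemma screw_has_period w A b T : d_invariant G w -> 0 < T ->
  elts G (screw A b (T *: w)) -> has_period (line w b) T.
Proof.
move=> invw T0 GT; apply/line_curve_period => //; split=> //.
by exists (screw A b (T *: w)); rewrite // act_screw.
Qed.

Lemma has_period_screw w x T : d_invariant G w -> has_period (line w x) T ->
  0 < T /\ exists A, elts G (screw A x (T *: w)).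
Proof.
move=> invw /(line_curve_period _ _ invw)[T0 [g Gg /act_screwP gE]].
by split=> //; exists g.1; rewrite -gE.
Qed.

Lemma finite_order_translation w A b s : d_invariant G w -> 0 < s ->
    elts G (screw A b (s *: w)) -> finite_order A ->
  exists2 T, 0 < T & elts G (screw 1%:M b (T *: w)).
Proof.
move=> invw s0 Gs [k k0 Ak]; exists (k%:R * s).
  by rewrite mulr_gt0 ?ltr0n.
rewrite -Ak -scalerA; apply: screw_exp => //.
by rewrite -scalemxAr (invw _ Gs : A *m w = w).
Qed.

Lemma generic_line w : w != 0 -> d_invariant G w ->
  exists x, forall T, has_period (line w x) T -> elts G (screw 1%:M x (T *: w)).
Proof.
move=> w0 invw; have [x xgen] := generic_point discreteG w0 invw.
exists x => T /(line_curve_period _ _ invw)[_ [g Gg gx]].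
by have g1 := xgen _ _ Gg gx; have /act_screwP gE := gx; rewrite -g1 -gE.
Qed.

(** If s were a multiple of T0, removing that multiple of the translation
    would leave a rotation of G fixing b, contrary to freeness; hence the
    remainder of s modulo T0 is positive, and it is a period of the axis. *)
Lemma screw_axis_short_period w A b s T0 :
    d_invariant G w -> 0 < s -> elts G (screw A b (s *: w)) -> A != 1%:M ->
    0 < T0 -> elts G (screw 1%:M b (T0 *: w)) ->
  exists2 T, has_period (line w b) T & T < T0.
Proof.
move=> invw s0 Gs A1 T00 G0.
pose m := Num.truncn (s / T0).
have Aw : A *m w = w := invw _ Gs.
have Gr : elts G (screw A b ((s - m%:R * T0) *: w)).
  have := screw_subM m Gs G0; rewrite -scalemxAr Aw scalerA -scalerBl; exact.
have /truncn_itv : 0 <= s / T0 by rewrite divr_ge0 ?ltW.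
rewrite -/m ler_pdivlMr // ltr_pdivrMr // -natr1 => /andP[ms sm].
exists (s - m%:R * T0); last by lra.
apply: (screw_has_period _ _ Gr) => //; rewrite lt_def subr_ge0 ms andbT.
apply: contra_neq A1 => r0; have := act_screw A b 0; rewrite addr0.
rewrite r0 scale0r in Gr.
by move=> /(freeG Gr) [].
Qed.

(** The minimal period Tx of a generic line is realized by a translation, so
    it is a period of every line and thus the maximal minimal period; the
    axis of the screw has a strictly smaller one. *)
Lemma finite_screw_quasiregular w A b s :
    w != 0 -> d_invariant G w -> 0 < s -> elts G (screw A b (s *: w)) ->
    A != 1%:M -> finite_order A ->
  quasiregular (field w) /\ singular_quasiregular (field w) (line w b).
Proof.
move=> w0 invw s0 Gs A1 finA.
have [T T0 GT] := finite_order_translation invw s0 Gs finA.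
have [x0 x0gen] := generic_line w0 invw.
have [Tx minx] : exists Tx, minimal_period (line w x0) Tx.
  have perT := translation_has_period x0 invw T0 GT.
  exact: (closed_line_minimal_period discreteG w0 invw perT).
have [Tx0 _] := minx.1; have Gx := x0gen _ minx.1.
have [Tb minb] : exists Tb, minimal_period (line w b) Tb.
  have pers := screw_has_period invw s0 Gs.
  exact: (closed_line_minimal_period discreteG w0 invw pers).
have bx : Tb < Tx.
  have Gxb : elts G (screw 1%:M b (Tx *: w)).
    by have := Gx; rewrite /screw subrr !mul0mx.
  have [S perS] := screw_axis_short_period invw s0 Gs A1 Tx0 Gxb.
  exact/le_lt_trans/minb.2.
have icl x : integral_curve (field w) (line w x) by exact: line_curve_integral.
split.
  split=> [c /(integral_curve_line invw)[x ->]|].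
    by exists T; apply: translation_has_period GT.
  exists (line w b), (line w x0), Tb, Tx; split=> //.
  have [Tb0 _] := minb.1.
  rewrite !parallel_curve_length ?(ltW Tb0) ?(ltW Tx0) //.
  by rewrite (inj_eq (mulfI _)) ?(lt_eqF bx) // gt_eqF // sqrtr_gt0 dot_gt0.
split=> //; exists Tb, Tx; split=> //; split; first by exists (line w x0).
move=> c S /(integral_curve_line invw)[x ->] [_]; apply.
exact: translation_has_period Gx.
Qed.

Lemma infinite_screw_mixed w A b s :
    w != 0 -> d_invariant G w -> 0 < s -> elts G (screw A b (s *: w)) ->
    ~ finite_order A ->
  closed_and_nonclosed (field w) /\ singular_mixed (field w) (line w b).
Proof.
move=> w0 invw s0 Gs infA.
have icl x : integral_curve (field w) (line w x) by exact: line_curve_integral.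
have closedb : closed_curve (line w b) by exists s; apply: screw_has_period Gs.
do 2?split=> //; first by exists (line w b).
have [x0 x0gen] := generic_line w0 invw.
exists (line w x0) => // -[T perT]; apply: infA.
apply: (translation_finite_order discreteG invw perT.1 _ (ltW s0) Gs).
by have := x0gen _ perT; rewrite /screw subrr !mul0mx.
Qed.

(** Moving the base point along w does not change a screw motion along w, so
    the base point can be projected onto the orthogonal complement of w. *)
Lemma screw_element_recenter w A x s :
    w != 0 -> d_invariant G w -> 0 < s -> elts G (screw A x (s *: w)) ->
    A != 1%:M ->
  exists b, screw_element G A (s *: w) b.
Proof.
move=> w0 invw s0 Gs A1; pose lam := dot x w / dot w w.
exists (x - lam *: w); split=> //.
- have Aw : (1%:M - A) *m w = 0.
    by rewrite mulmxBl mul1mx (invw _ Gs : A *m w = w) subrr.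
  by rewrite mulmxBr -scalemxAr Aw scaler0 subr0.
- by rewrite scaler_eq0 negb_or gt_eqF.
- by move=> g Gg; rewrite -scalemxAr invw.
by rewrite dotZr dotBl dotZl mulfVK ?gt_eqF ?dot_gt0 // subrr mulr0.
Qed.

(** Two closed lines of different lengths have different minimal periods.
    The shorter one is not closed by a translation, which would close the
    longer one as well; the generic line supplies the translation that makes
    the rotation of finite order. *)
Lemma quasiregular_finite_screw w :
    w != 0 -> d_invariant G w -> quasiregular (field w) ->
  exists A b s, [/\ 0 < s, screw_element G A (s *: w) b & finite_order A].
Proof.
move=> w0 invw [allclosed [c1 [c2 [T1 [T2]]]]].
move=> [/(integral_curve_line invw)[x1 ->] /(integral_curve_line invw)[x2 ->]].
move=> min1 min2; have [T10 _] := min1.1; have [T20 _] := min2.1.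
rewrite !parallel_curve_length ?(ltW T10) ?(ltW T20) //.
have normw : Num.sqrt (dot w w) != 0 by rewrite gt_eqF // sqrtr_gt0 dot_gt0.
rewrite (inj_eq (mulfI normw)) => T12.
wlog {T12} lt12 : x1 x2 T1 T2 min1 min2 T10 T20 / T1 < T2.
  move=> H; move: T12; rewrite neq_lt => /orP[lt12|lt21].
    exact: (H x1 x2 T1 T2).
  exact: (H x2 x1 T2 T1).
have [x0 x0gen] := generic_line w0 invw.
have [T0 per0] := allclosed _ (line_curve_integral x0 invw).
have G0 := x0gen _ per0.
have [_ [A GA]] := has_period_screw invw min1.1.
have A1 : A != 1%:M.
  apply: contraTneq lt12 => A1; rewrite -leNgt; apply: min2.2.
  by apply: translation_has_period => //; rewrite A1 in GA; exact: GA.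
have [b sb] := screw_element_recenter w0 invw T10 GA A1.
exists A, b, T1; split=> //.
apply: (translation_finite_order discreteG invw per0.1 _ (ltW T10) GA).
by have := G0; rewrite /screw subrr !mul0mx.
Qed.

(** A screw of finite rotational order has a power which is a translation,
    and that would close every line. *)
Lemma mixed_infinite_screw w :
    w != 0 -> d_invariant G w -> closed_and_nonclosed (field w) ->
  exists A b s, [/\ 0 < s, screw_element G A (s *: w) b & ~ finite_order A].
Proof.
move=> w0 invw [[c1 /(integral_curve_line invw)[x1 ->] [T1 per1]]].
move=> [c2 /(integral_curve_line invw)[x2 ->] nclosed].
have [T10 [A GA]] := has_period_screw invw per1.
have infA : ~ finite_order A.
  move=> /(finite_order_translation invw T10 GA)[T T0 GT]; apply: nclosed.
  by exists T; apply: translation_has_period GT.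
have [|b sb] := screw_element_recenter w0 invw T10 GA; last by exists A, b, T1.
by apply/eqP => A1; apply: infA; exists 1; rewrite // A1 expr1n.
Qed.

(** The quasiregular and the mixed case have the same formal structure: P is
    the property of the field, S singles out its singular trajectories, and
    Q is the condition on the rotation. In the converse direction the field
    is w and the screw translates by s *: w, whence the factor s^-1. *)
Lemma parallel_fields_from_screws
    (P : quot_field G -> Prop)
    (S : quot_field G -> (R -> quot_space G) -> Prop)
    (Q : 'M[R]_n -> Prop) :
  (forall w A b s, w != 0 -> d_invariant G w -> 0 < s ->
     elts G (screw A b (s *: w)) -> A != 1%:M -> Q A ->
     P (field w) /\ S (field w) (line w b)) ->
  (forall w, w != 0 -> d_invariant G w -> P (field w) ->
     exists A b s, [/\ 0 < s, screw_element G A (s *: w) b & Q A]) ->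
  [/\ (exists X : quot_field G, [/\ killing X, constant_length X & P X])
      <-> (exists A a b, screw_element G A a b /\ Q A),
      forall A a b, screw_element G A a b -> Q A ->
        let X := field a in
        [/\ killing X, constant_length X, P X
          & exists2 c, S X c & passes_through c (quot_proj G b)]
    & forall X : quot_field G, killing X -> constant_length X -> P X ->
        exists A a b r,
          [/\ screw_element G A a b, Q A, 0 < r, X = field (r *: a)
            & exists2 c, S X c & passes_through c (quot_proj G b)]].
Proof.
move=> screwP Pscrew.
have through w b : passes_through (line w b) (quot_proj G b).
  by exists 0; rewrite /line_curve scale0r addr0.
have direct A a b : screw_element G A a b -> Q A ->
    [/\ killing (field a), constant_length (field a), P (field a)
      & exists2 c, S (field a) c & passes_through c (quot_proj G b)].
  move=> [GA a0 inva _ A1] QA.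
  have Ga : elts G (screw A b (1 *: a)) by rewrite scale1r.
  have [Pa Sa] := screwP a A b 1 a0 inva ltr01 Ga A1 QA.
  have [kX lX] := parallel_killing_const_length a0 inva.
  by split=> //; exists (line a b).
have converse X : killing X -> constant_length X -> P X ->
    exists A a b r,
      [/\ screw_element G A a b, Q A, 0 < r, X = field (r *: a)
        & exists2 c, S X c & passes_through c (quot_proj G b)].
  move=> kX lX.
  have [w [w0 invw ->]] := const_length_killing_parallel freeG kX lX.
  move=> /(Pscrew w w0 invw)[A [b [s [s0 sb QA]]]].
  have [GA _ _ _ A1] := sb.
  exists A, (s *: w), b, s^-1; split=> //; first by rewrite invr_gt0.
    by rewrite scalerA mulVf ?gt_eqF // scale1r.
  by exists (line w b) => //; have [] := screwP w A b s.
split=> //; split=> [[X [kX lX PX]]|[A [a [b [sb QA]]]]].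
  by have [A [a [b [r [sb QA _ _ _]]]]] := converse X kX lX PX; exists A, a, b.
by exists (field a); have [] := direct A a b sb QA.
Qed.

End ParallelFlows.
Theorem theorem25 (R : realType) (n : nat) (Gamma : isom_group R n)
    (Gamma_discrete : discrete_group Gamma)
    (Gamma_free : acts_freely Gamma) :
  (* quasiregular fields and elements of finite rotational order *)
  [/\ (exists X : quot_field Gamma,
         [/\ killing X, constant_length X & quasiregular X])
      <->
      (exists (A : 'M[R]_n) (a b : 'cV[R]_n),
         screw_element Gamma A a b /\ finite_order A),
      forall (A : 'M[R]_n) (a b : 'cV[R]_n),
        screw_element Gamma A a b -> finite_order A ->
        let X := dproj Gamma (affine_field 0 a) in
        [/\ killing X, constant_length X, quasiregular X
          & exists2 c, singular_quasiregular X c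
                     & passes_through c (quot_proj Gamma b)]
    & forall X : quot_field Gamma,
        killing X -> constant_length X -> quasiregular X ->
        exists (A : 'M[R]_n) (a b : 'cV[R]_n) (r : R),
          [/\ screw_element Gamma A a b, finite_order A, 0 < r,
              X = dproj Gamma (affine_field 0 (r *: a))
            & exists2 c, singular_quasiregular X c
                       & passes_through c (quot_proj Gamma b)]]
  /\
  (* fields with closed and non-closed trajectories and elements of infinite
     rotational order *)
  [/\ (exists X : quot_field Gamma,
         [/\ killing X, constant_length X & closed_and_nonclosed X])
      <->
      (exists (A : 'M[R]_n) (a b : 'cV[R]_n),
         screw_element Gamma A a b /\ ~ finite_order A),
      forall (A : 'M[R]_n) (a b : 'cV[R]_n),
        screw_element Gamma A a b -> ~ finite_order A ->
        let X := dproj Gamma (affine_field 0 a) in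
        [/\ killing X, constant_length X, closed_and_nonclosed X
          & exists2 c, singular_mixed X c
                     & passes_through c (quot_proj Gamma b)]
    & forall X : quot_field Gamma,
        killing X -> constant_length X -> closed_and_nonclosed X ->
        exists (A : 'M[R]_n) (a b : 'cV[R]_n) (r : R),
          [/\ screw_element Gamma A a b, ~ finite_order A, 0 < r,
              X = dproj Gamma (affine_field 0 (r *: a))
            & exists2 c, singular_mixed X c
                       & passes_through c (quot_proj Gamma b)]].
Proof.
split; apply: parallel_fields_from_screws => //.
- exact: finite_screw_quasiregular.
- exact: quasiregular_finite_screw.
- by move=> w A b s w0 invw s0 Gs _; apply: infinite_screw_mixed Gs.
- exact: mixed_infinite_screw.
Qed.
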